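(* Let $x=(u,z)\in V$ be the solution of the reduced and rescaled optimality system $$b_\alpha(x,\varphi)=\langle f,\varphi_2\rangle_2-\tfrac1{\sqrt\alpha}(u_d,I\varphi_1)_W\qquad\text{for all }\varphi=(\varphi_1,\varphi_2)\in V ,$$ let $q:=\Pi_K(-\tfrac1{\sqrt\alpha}C^*z)$ be the exact control, let $\tilde x=(\tilde u,\tilde z)$ with $\tilde u\in V_1$, $\tilde z\in V_2$ arbitrary, and let $\tilde q\in K$ be some approximate control. Then there are constants $c,\overline C>0$, depending only on $m_a,M_a,M$ and $\alpha$, such that, with $$E:=d_\alpha(x,\tilde x)+\frac{M}{M_a}\|q-\tilde q\|_Q$$ and $$\mathcal R:=\Big(\|f-A\tilde u+C\tilde q\|_{2,*}^2+\big\|A^*\tilde z-\tfrac1{\sqrt\alpha}I^*(I\tilde u-u_d)\big\|_{1,*}^2\Big)^{1/2}+\frac{M}{M_a}\Big\|\tilde q-\Pi_K\big(-\tfrac1{\sqrt\alpha}C^*\tilde z\big)\Big\|_Q,$$ one has $$c\,\mathcal R\le E\le \overline C\,\mathcal R .$$ Moreover, for $\alpha\to0$ (with all other data fixed) the constants have the same asymptotics as the constants $1/M_a$ and $\kappa/m_a$ respectively, i.e. $c$ stays bounded away from $0$ and $\overline C=O(\kappa)=O(1/\sqrt\alpha)$.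
   Context: Let $V_1,V_2,Q,W$ be real Hilbert spaces with scalar products $(\cdot,\cdot)_1,(\cdot,\cdot)_2,(\cdot,\cdot)_Q,(\cdot,\cdot)_W$ and induced norms $\|\cdot\|_1,\|\cdot\|_2,\|\cdot\|_Q,\|\cdot\|_W$; $\langle\cdot,\cdot\rangle_i$ is the duality pairing of $V_i^*\times V_i$ and $\|\cdot\|_{i,*}$ the dual norm on $V_i^*$. $A:V_1\to V_2^*$ is a linear isomorphism with associated bilinear form $a(v_1,v_2)=\langle Av_1,v_2\rangle_2$ on $V_1\times V_2$, that is: $M_a:=\sup_{\|v_1\|_1=1}\sup_{\|v_2\|_2=1}a(v_1,v_2)<\infty$; if $v_1\in V_1$ satisfies $a(v_1,v_2)=0$ for all $v_2\in V_2$ then $v_1=0$; and $m_a:=\inf_{\|v_2\|_2=1}\sup_{\|v_1\|_1=1}a(v_1,v_2)>0$. $C:Q\to V_2^*$ is linear and bounded with constant $M_C$, $I:V_1\to W$ is linear and bounded with constant $M_I$, and $M:=\max\{M_I,M_C\}$. Further $f\in V_2^*$, $u_d\in W$, $\alpha>0$, and $K\subset Q$ is nonempty, closed and convex with metric projection $\Pi_K:Q\to K$. Adjoints are defined by $A^*v_2=a(\cdot,v_2)$, $(q,C^*v_2)_Q=\langle Cq,v_2\rangle_2$, $\langle I^*w,v_1\rangle_1=(Iv_1,w)_W$. $V:=V_1\times V_2$ with $\|v\|:=(\|v_1\|_1^2+\|v_2\|_2^2)^{1/2}$ for $v=(v_1,v_2)$. For $v,\varphi\in V$, $$b_\alpha(v,\varphi):=a(v_1,\varphi_2)+a(\varphi_1,v_2)-\big(\Pi_K(-\tfrac1{\sqrt\alpha}C^*v_2),C^*\varphi_2\big)_Q-\tfrac1{\sqrt\alpha}(Iv_1,I\varphi_1)_W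 .$$ The optimality system has a unique solution. For $v,w\in V$, $$\delta_\alpha(v,w)^2:=\alpha\big\|\Pi_K(-\tfrac1{\sqrt\alpha}C^*v_2)-\Pi_K(-\tfrac1{\sqrt\alpha}C^*w_2)\big\|_Q^2+\|I(v_1-w_1)\|_W^2,$$ $$d_\alpha(v,w):=\|v-w\|+\tfrac1{\sqrt\alpha}\tfrac{M}{M_a}\,\delta_\alpha(v,w).$$ Finally $$\kappa:=\frac{1+2L}{1+L}\Big(1+\frac{M}{m_a}(1+2L)\Big),\qquad L:=\frac{M}{\sqrt\alpha}.$$ *)

(* Defs.v *)
From HB Require Import structures.
From mathcomp Require Import all_boot all_order all_algebra.
From mathcomp Require Import all_classical all_reals all_analysis.

Set Implicit Arguments.
Unset Strict Implicit.
Unset Printing Implicit Defensive.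

Import Order.TTheory GRing.Theory Num.Theory.
Import numFieldNormedType.Exports.

Local Open Scope classical_set_scope.
Local Open Scope ring_scope.

(* Real Hilbert spaces: the norm is the one induced by the scalar product, so
   positive definiteness of [inner] is a consequence of [inner_norm]. *)
HB.mixin Record isHilbert (R : realType) V & CompleteNormedModule R V := {
  inner : V -> V -> R ;
  innerC : forall u v, inner u v = inner v u ;
  innerDl : forall u v w, inner (u + v) w = inner u w + inner v w ;
  innerZl : forall (k : R) u v, inner (k *: u) v = k * inner u v ;
  inner_norm : forall u, inner u u = `|u| ^+ 2
}.

#[short(type="hilbertType")]
HB.structure Definition Hilbert (R : realType) :=
  {V of CompleteNormedModule R V & isHilbert R V}.

Section Dual.
Variables (R : realType) (V : hilbertType R).

Definition bounded_functional : {pred V -> R^o} :=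
  [pred l | `[< linear l /\ continuous l >]].

Lemma bounded_functional_submod : submod_closed bounded_functional.
Proof.
split.
  rewrite inE; split=> [k u v|x]; first by rewrite /= scaler0 addr0.
  exact: cvg_cst.
move=> k l m; rewrite !inE => -[ll lc] [ml mc]; split=> [j u v|x].
  rewrite !fctE /= ll ml !scalerDr !scalerA [k * j]mulrC.
  by rewrite -!addrA; congr (_ + _); rewrite addrCA.
by apply: cvgD; [apply: cvgZl_tmp; exact: lc|exact: mc].
Qed.

HB.instance Definition _ :=
  GRing.isSubmodClosed.Build R (V -> R^o) bounded_functional
    bounded_functional_submod.

Record dual := Dual { dual_val :> V -> R^o ; _ : dual_val \in bounded_functional }.

HB.instance Definition _ := [isSub for dual_val].
HB.instance Definition _ := [Choice of dual by <:].
HB.instance Definition _ := [SubChoice_isSubLmodule of dual by <:].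

(* Stated for arbitrary functions, so that it also applies to the functionals
   [a (_, v2)] and [I^* w], which are continuous only because the operators
   they are built from are bounded. *)
Definition dual_norm (l : V -> R^o) : R :=
  sup [set `|l v| | v in [set v : V | `|v| <= 1]].

Definition unit_sphere : set V := [set v | `|v| = 1].

(* The default value 0 is irrelevant when [K] is nonempty, closed and convex. *)
Definition proj (K : set V) (p : V) : V :=
  xget 0 [set k | K k /\ forall k', K k' -> `|p - k| <= `|p - k'|].

End Dual.

Section Operators.
Variables (R : realType) (V1 V2 Q W : hilbertType R).

(* The values are extended reals, so that their finiteness is a genuine
   hypothesis; over a trivial space they are infinite. *)
Definition sup_sup (A : V1 -> dual V2) : \bar R :=
  ereal_sup [set ereal_sup [set (A v1 v2)%:E | v2 in @unit_sphere R V2]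
            | v1 in @unit_sphere R V1].

Definition inf_sup (A : V1 -> dual V2) : \bar R :=
  ereal_inf [set ereal_sup [set (A v1 v2)%:E | v1 in @unit_sphere R V1]
            | v2 in @unit_sphere R V2].

(* [A^* v2 = a (_, v2)] *)
Definition adjA (A : V1 -> dual V2) (v2 : V2) : V1 -> R^o :=
  fun v1 => A v1 v2.

(* [C^* v2] is the Riesz representative in [Q] of [q |-> <C q, v2>]. *)
Definition adjC (C : Q -> dual V2) (v2 : V2) : Q :=
  xget 0 [set p | forall q, inner q p = C q v2].

(* [<I^* w, v1> = (I v1, w)] *)
Definition adjI (I : V1 -> W) (w : W) : V1 -> R^o :=
  fun v1 => inner (I v1) w.

(* [V1 * V2] carries the max norm in the library. *)
Definition l2norm (v : V1 * V2) : R := Num.sqrt (`|v.1| ^+ 2 + `|v.2| ^+ 2).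

Definition control (C : Q -> dual V2) (K : set Q) (alpha : R) (v2 : V2) : Q :=
  proj K (- (Num.sqrt alpha)^-1 *: adjC C v2).

Definition b_form (A : V1 -> dual V2) (C : Q -> dual V2) (I : V1 -> W)
    (K : set Q) (alpha : R) (v phi : V1 * V2) : R :=
  A v.1 phi.2 + A phi.1 v.2
  - inner (control C K alpha v.2) (adjC C phi.2)
  - (Num.sqrt alpha)^-1 * inner (I v.1) (I phi.1).

Definition solves (A : V1 -> dual V2) (C : Q -> dual V2) (I : V1 -> W)
    (K : set Q) (alpha : R) (f : dual V2) (ud : W) (x : V1 * V2) : Prop :=
  forall phi : V1 * V2,
    b_form A C I K alpha x phi
    = f phi.2 - (Num.sqrt alpha)^-1 * inner ud (I phi.1).

Definition delta_alpha (C : Q -> dual V2) (I : V1 -> W) (K : set Q) (alpha : R)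
    (v w : V1 * V2) : R :=
  Num.sqrt (alpha * `|control C K alpha v.2 - control C K alpha w.2| ^+ 2
            + `|I (v.1 - w.1)| ^+ 2).

Definition d_alpha (C : Q -> dual V2) (I : V1 -> W) (K : set Q) (Ma M alpha : R)
    (v w : V1 * V2) : R :=
  l2norm (v - w) + (Num.sqrt alpha)^-1 * (M / Ma) * delta_alpha C I K alpha v w.

End Operators.

Definition kappa (R : realType) (ma M alpha : R) : R :=
  let L := M / Num.sqrt alpha in
  (1 + 2 * L) / (1 + L) * (1 + M / ma * (1 + 2 * L)).

(* Main.v *)
Require Import Defs.
From HB Require Import structures.
From mathcomp Require Import all_boot all_order all_algebra.
From mathcomp Require Import all_classical all_reals all_analysis.
From mathcomp Require Import ring lra.

(* Write [s] for [sqrt alpha], [e = u - ut], [y = z - zt] for the errors of state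
   and adjoint state, [qb] for the projected control of [zt], and [p = q - qb].
   The inf-sup condition bounds [|e|] and [|y|] by the residuals plus [M |p|] and
   [(M / s) |I e|]; on [V1] it is obtained by duality from the one on [V2].  Testing
   the residuals with [(e, y)] cancels [a(e, y)], and the monotonicity of the
   projection leaves [delta_alpha^2 <= s * residual * |(e, y)|].  Solving this
   quadratic system of inequalities gives the factor [kappa / ma].  The discrepancy
   between [qt] and [qb] enters as a perturbation of the state residual.  The lower
   bound is continuity of the operators. *)

Set Implicit Arguments.
Unset Strict Implicit.
Unset Printing Implicit Defensive.

Import Order.TTheory GRing.Theory Num.Theory.
Import numFieldNormedType.Exports.

Local Open Scope classical_set_scope.
Local Open Scope ring_scope.

(* [proj] is shadowed by the projections of product topologies. *)
Local Notation proj := Defs.proj.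

(** * Limit arguments and existence of minimizers *)

(** This replaces the passage [t -> 0] in the first-order conditions of minimizers: a positive [b]
    is refuted by one explicit small [t]. *)
Lemma le0_of_small_mul (R : realType) (b d : R) :
  (forall t, 0 < t -> t <= 1 -> b <= t * d) -> b <= 0.
Proof.
move=> h; rewrite leNgt; apply/negP => b0.
have D0 : 0 < `|d| + b + 1 by rewrite -addrA ltr_wpDl ?addr_gt0.
have t1 : b / (2 * (`|d| + b + 1)) <= 1.
  by rewrite ler_pdivrMr ?mulr_gt0//; have := normr_ge0 d; lra.
have D2 : 0 < 2 * (`|d| + b + 1) by rewrite mulr_gt0.
have := h _ (divr_gt0 b0 D2) t1.
rewrite mulrAC ler_pdivlMr ?mulr_gt0// leNgt => /negP; apply.
by rewrite ltr_pM2l//; have := ler_norm d; lra.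
Qed.

Lemma bounded_dist_continuous (R : realType) (V W : normedModType R)
    (f : V -> W) (B : R) :
  (forall x y, `|f x - f y| <= B * `|x - y|) -> continuous f.
Proof.
move=> fB x; apply/(@cvgrPdist_lt _ _ _ (nbhs x)) => e e0; near=> y.
apply: le_lt_trans (fB _ _) _.
apply: (@le_lt_trans _ _ ((`|B| + 1) * `|x - y|)).
  by rewrite ler_wpM2r// ler_wpDr// ler_norm.
rewrite -ltr_pdivlMl ?ltr_wpDl// mulrC.
by near: y; apply: cvgr_dist_lt => //; rewrite divr_gt0 ?ltr_wpDl.
Unshelve. all: by end_near. Qed.

(* The sublevel sets of [J] close to its infimum form a Cauchy filter. *)
Lemma ex_minimizer (R : realType) (X : completeNormedModType R) (S : set X)
    (J : X -> R) (c m : R) :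
  closed S -> S !=set0 -> continuous J -> 0 < c ->
  (forall x, S x -> m <= J x) ->
  (forall x y, S x -> S y ->
     exists2 z, S z & `|x - y| ^+ 2 <= c * (J x + J y - 2 * J z)) ->
  exists2 x, S x & forall y, S y -> J x <= J y.
Proof.
move=> clS [s0 Ss0] cJ c0 mJ mid.
pose i := inf (J @` S).
have hi : has_inf (J @` S).
  by split; [exists (J s0), s0|exists m => _ [x Sx <-]; exact: mJ].
have iJ x : S x -> i <= J x by move=> Sx; apply: ge_inf; [case: hi|exists x].
pose B e := [set x | S x /\ J x <= i + e].
pose F := filter_from [set e : R | 0 < e] B.
have FF : ProperFilter F.
  apply: filter_from_proper.
    apply: filter_from_filter; first by exists 1 => /=.
    move=> e e' /= e0 e'0; exists (Num.min e e') => /=; first by rewrite lt_min e0.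
    move=> x [Sx]; rewrite -lerBlDl le_min !lerBlDl => /andP[? ?].
    by split; split.
  move=> e /= e0; have [_ [x Sx <-] /ltW] := inf_adherent e0 hi.
  by exists x; split.
have cF : cauchy F.
  apply: cauchy_exP => e e0.
  (* Two points of [B d] have values at most [i + d] and the intermediate point has value at least
     [i], so their squared distance is at most [c * (2 * d) = e ^+ 2 / 2]. *)
  pose d := e ^+ 2 / (4 * c).
  have d0 : 0 < d by rewrite divr_gt0 ?exprn_gt0 ?mulr_gt0.
  have [x [Sx Jx]] : B d !=set0.
    have [_ [x Sx <-] /ltW] := inf_adherent d0 hi.
    by exists x; split.
  exists x, d => //= y [Sy Jy]; rewrite -ball_normE /=.
  rewrite -(@ltr_pXn2r _ 2) ?nnegrE ?(ltW e0)//.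
  have [z Sz /le_lt_trans] := mid _ _ Sx Sy; apply.
  have : c * (J x + J y - 2 * J z) <= c * (2 * d).
    by rewrite ler_pM2l//; have := iJ _ Sz; lra.
  move=> /le_lt_trans; apply.
  have -> : c * (2 * d) = e ^+ 2 / 2 by rewrite /d; field; rewrite gt_eqF.
  have := exprn_gt0 2 e0; lra.
have cvF : F --> lim F by apply/cauchy_cvgP.
have clB e : closed (B e).
  have -> : B e = S `&` J @^-1` [set y | y <= i + e] by [].
  by apply: closedI => //; apply: (continuous_closedP J).1 => //;
    exact: (@closed_le R (i + e)).
have limB e : 0 < e -> B e (lim F).
  by move=> e0; apply: (@closed_cvg _ _ F _ id (B e) (clB e) _ _ cvF); exists e.
exists (lim F); first by have [] := limB _ ltr01.
move=> y /iJ; apply: le_trans; rewrite -subr_le0.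
apply: (@le0_of_small_mul _ _ 1) => t t0 _; rewrite mulr1 lerBlDl.
by have [] := limB _ t0.
Qed.

(** * Scalar product identities and Cauchy-Schwarz *)

Section Inner.
Variables (R : realType) (V : hilbertType R).
Implicit Types u v w : V.

Lemma innerDr u v w : inner u (v + w) = inner u v + inner u w.
Proof. by rewrite innerC innerDl !(innerC u). Qed.

Lemma innerZr k u v : inner u (k *: v) = k * inner u v.
Proof. by rewrite innerC innerZl innerC. Qed.

Lemma inner0l u : inner 0 u = 0.
Proof. by rewrite -(scale0r 0) innerZl mul0r. Qed.

Lemma inner0r u : inner u 0 = 0.
Proof. by rewrite innerC inner0l. Qed.

Lemma innerNl u v : inner (- u) v = - inner u v.
Proof. by rewrite -scaleN1r innerZl mulN1r. Qed.

Lemma innerNr u v : inner u (- v) = - inner u v.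
Proof. by rewrite innerC innerNl innerC. Qed.

Definition innerE :=
  (@innerDl R V, innerDr, innerNl, innerNr, @innerZl R V, innerZr).

Lemma normD_sqr u v : `|u + v| ^+ 2 = `|u| ^+ 2 + 2 * inner u v + `|v| ^+ 2.
Proof. by rewrite -!inner_norm !innerE (innerC v u); ring. Qed.

Lemma normB_sqr u v : `|u - v| ^+ 2 = `|u| ^+ 2 - 2 * inner u v + `|v| ^+ 2.
Proof. by rewrite normD_sqr innerNr normrN mulrN. Qed.

Lemma inner_le u v : inner u v <= `|u| * `|v|.
Proof.
have : `|u + v| ^+ 2 <= (`|u| + `|v|) ^+ 2 by rewrite ler_sqr ?nnegrE ?ler_normD.
by rewrite normD_sqr; lra.
Qed.

Lemma norm_inner_le u v : `|inner u v| <= `|u| * `|v|.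
Proof.
rewrite ler_norml inner_le andbT lerNl -innerNl.
by rewrite (le_trans (inner_le _ _))// normrN.
Qed.

Lemma inner_inj u v : (forall w, inner w u = inner w v) -> u = v.
Proof.
move=> uv; apply/eqP; rewrite -subr_eq0 -normr_eq0 -sqrf_eq0 -inner_norm.
by rewrite innerDr innerNr uv subrr.
Qed.

End Inner.

(** * Metric projection onto a closed convex set *)

Section Projection.
Variables (R : realType) (Q : hilbertType R) (K : set Q).
Hypotheses (K0 : K !=set0) (clK : closed K)
  (cvK : convex_set (K : set (convex_lmodType Q))).

Lemma convex_segment x y (t : R) :
  0 <= t -> t <= 1 -> K x -> K y -> K (x + t *: (y - x)).
Proof.
move=> t0 t1 Kx Ky.
have := cvK (Itv01 t0 t1) (mem_set Ky) (mem_set Kx).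
rewrite inE; congr (K _); rewrite /conv /= /unstable.onem.
by rewrite scalerBl scale1r scalerBr addrCA.
Qed.

(** By the parallelogram law the squared distance satisfies the midpoint hypothesis of
    [ex_minimizer] with constant 2, and convexity keeps the midpoint in [K]. So [proj] never takes
    its default value. *)
Lemma projP p : K (proj K p) /\ forall k, K k -> `|p - proj K p| <= `|p - k|.
Proof.
have cJ : continuous (fun k => `|p - k| ^+ 2 : R).
  move=> k; apply: cvgM; apply: cvg_norm; apply: cvgB; try exact: cvg_id;
    exact: cvg_cst.
have [||x y Kx Ky|k Kk kmin] := @ex_minimizer _ _ K _ 2 0 clK K0 cJ.
- by rewrite ltr0n.
- by move=> x _; rewrite exprn_ge0.
- exists (x + 2^-1 *: (y - x)); first by apply: convex_segment => //; lra.
  rewrite -!inner_norm !innerE (innerC y x) (innerC x p) (innerC y p); lra.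
apply: (@xgetPex _ 0 [set k | K k /\ forall k', K k' -> `|p - k| <= `|p - k'|]).
exists k; split=> // k' /kmin.
by rewrite ler_sqr ?nnegrE.
Qed.

Lemma proj_in p : K (proj K p).
Proof. by have [] := projP p. Qed.

(** Moving from the projection towards [k] by a fraction [t] cannot decrease the distance to [p];
    dividing by [t] leaves a quadratic term that vanishes with [t]. *)
Lemma proj_variational p k : K k -> inner (p - proj K p) (k - proj K p) <= 0.
Proof.
move=> Kk; have [Kq qmin] := projP p; set q := proj K p in Kq qmin *.
suff : 2 * inner (p - q) (k - q) <= 0 by lra.
apply: (@le0_of_small_mul _ _ (`|k - q| ^+ 2)) => t t0 t1.
have := qmin _ (convex_segment (ltW t0) t1 Kq Kk).
rewrite -ler_sqr ?nnegrE// opprD addrA [leRHS]normB_sqr innerZr normrZ exprMn.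
rewrite (gtr0_norm t0) => h; rewrite -(@ler_pM2l _ t)//; lra.
Qed.

(** Each projection is a competitor in the variational inequality of the other; the two inequalities
    are added. *)
Lemma proj_monotone p1 p2 :
  `|proj K p1 - proj K p2| ^+ 2 <= inner (p1 - p2) (proj K p1 - proj K p2).
Proof.
have := proj_variational p1 (proj_in p2); have := proj_variational p2 (proj_in p1).
rewrite -inner_norm; set q1 := proj K p1; set q2 := proj K p2.
rewrite !innerE (innerC q2 q1); lra.
Qed.

End Projection.

(** * Functionals and the dual norm *)

Section Duality.
Variables (R : realType) (V : hilbertType R).
Implicit Types l m : dual V.

Lemma dual_linear l : linear l.
Proof. by case: l => l /=; rewrite inE => -[]. Qed.

HB.instance Definition _ l :=
  GRing.isLinear.Build R V R^o *:%R (dual_val l) (dual_linear l).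

Lemma dualDE l m v : (l + m) v = l v + m v. Proof. by []. Qed.
Lemma dualNE l v : (- l) v = - l v. Proof. by []. Qed.
Lemma dualZ l k v : l (k *: v) = k * l v. Proof. exact: linearZ. Qed.

Lemma lin_dualB (U : lmodType R) (A : {linear U -> dual V}) u w v :
  A (u - w) v = A u v - A w v.
Proof. by rewrite linearB. Qed.

Lemma lin_dualZ (U : lmodType R) (A : {linear U -> dual V}) k u v :
  A (k *: u) v = k * A u v.
Proof. by rewrite linearZ. Qed.

Lemma dual_bounded l : exists B, forall v, `|l v| <= B * `|v|.
Proof.
have lc : continuous l by case: l => l /=; rewrite inE => -[].
have /pinfty_ex_gt0[B _ lB] :=
  (linear_boundedP l).1 ((linear_bounded_continuous l).2 lc).
by exists B.
Qed.

(** The constant [B] certifies that the supremum is taken over a bounded set. Plain functions are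
    allowed so that the adjoint residual, which is not an element of [dual], is covered. *)
Lemma dual_norm_bound (l : V -> R^o) (B : R) :
  (forall k v, l (k *: v) = k * l v) -> (forall v, `|l v| <= B * `|v|) ->
  forall v, `|l v| <= dual_norm l * `|v|.
Proof.
move=> lZ lB v; have [->|v0] := eqVneq v 0.
  by rewrite normr0 mulr0 -(scale0r 0) lZ mul0r normr0.
have v_gt0 : 0 < `|v| by rewrite normr_gt0.
rewrite -ler_pdivrMr// mulrC -[X in X * _](gtr0_norm (_ : 0 < `|v|^-1)) ?invr_gt0//.
rewrite -normrM -lZ; apply: ub_le_sup.
  exists `|B| => _ [w /= w1 <-]; apply: (le_trans (lB w)).
  apply: (@le_trans _ _ (`|B| * `|w|)); first by rewrite ler_wpM2r ?ler_norm.
  by rewrite -[leRHS]mulr1 ler_wpM2l.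
by exists (`|v|^-1 *: v) => //=; rewrite normrZ gtr0_norm ?invr_gt0// mulVf ?gt_eqF.
Qed.

Lemma dual_norm_le (l : V -> R^o) (B : R) :
  0 <= B -> (forall v, `|l v| <= B * `|v|) -> dual_norm l <= B.
Proof.
move=> B0 lB; apply: ge_sup.
  by exists `|l 0|; exists 0 => //=; rewrite normr0.
move=> _ [v /= v1 <-]; apply: (le_trans (lB v)).
by rewrite -[leRHS]mulr1 ler_wpM2l.
Qed.

Lemma dual_le l v : `|l v| <= dual_norm l * `|v|.
Proof.
have [B lB] := dual_bounded l.
by apply: (@dual_norm_bound _ B) => // k w; exact: dualZ.
Qed.

Lemma dual_norm_ge0 (l : V -> R^o) : 0 <= dual_norm l.
Proof.
rewrite /dual_norm; set S := (X in sup X).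
have S0 : S `|l 0| by exists 0 => //=; rewrite normr0.
(* For an unbounded set [sup] is 0 by convention. *)
have [[_ ubS]|/sup_out -> //] := pselect (has_sup S).
by apply: le_trans (ub_le_sup ubS S0).
Qed.

End Duality.

(** * Riesz representation *)

Section Riesz.
Variables (R : realType) (V : hilbertType R).

(** The representative minimizes [J], which is bounded below by [- B ^+ 2] and satisfies the
    parallelogram identity. Its first-order condition is an inequality in every direction [h];
    taking [- h] as well gives equality. *)
Lemma riesz (l : V -> R) (B : R) :
  (forall k u v, l (k *: u + v) = k * l u + l v) ->
  (forall v, `|l v| <= B * `|v|) ->
  exists p, forall v, inner v p = l v.
Proof.
move=> lin lB.
have l0 : l 0 = 0 by have := lB 0; rewrite normr0 mulr0 normr_le0 => /eqP.
have lZ k v : l (k *: v) = k * l v by rewrite -[k *: v]addr0 lin l0 addr0.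
have lD u v : l (u + v) = l u + l v by rewrite -[u]scale1r lin mul1r scale1r.
have lN v : l (- v) = - l v by rewrite -scaleN1r lZ mulN1r.
pose J v := `|v| ^+ 2 - 2 * l v.
have cJ : continuous J.
  have cl : continuous (l : V -> R^o).
    apply: (@bounded_dist_continuous _ _ _ _ B) => x y.
    by rewrite -lN -lD lB.
  move=> v; apply: cvgB.
    by apply: cvgM; apply: cvg_norm; exact: cvg_id.
  by apply: cvgM; [exact: cvg_cst|exact: cl].
have [||v _|x y _ _|p _ pmin] := @ex_minimizer _ _ setT J 2 (- B ^+ 2) closedT _ cJ.
- by exists 0.
- by rewrite ltr0n.
- have := sqr_ge0 (`|v| - B); rewrite /J; have := ler_norm (l v).
  have := lB v; lra.
- exists (2^-1 *: x + 2^-1 *: y) => //.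
  rewrite /J lD !lZ -!inner_norm !innerE (innerC y x); lra.
have pl h : l h <= inner p h.
  suff : 2 * (l h - inner p h) <= 0 by lra.
  apply: (@le0_of_small_mul _ _ (`|h| ^+ 2)) => t t0 _.
  have := pmin (p + t *: h) I; rewrite /J normD_sqr lD lZ innerZr normrZ exprMn.
  by rewrite (gtr0_norm t0) => H; rewrite -(@ler_pM2l _ t)//; lra.
exists p => v; rewrite innerC; apply/eqP; rewrite eq_le pl andbT.
by have := pl (- v); rewrite lN innerNr lerN2.
Qed.

End Riesz.

(** * Hilbert adjoints; they are applied to both [C] and [A] *)

Section Adjoint.
Variables (R : realType) (X V : hilbertType R) (C : {linear X -> dual V}) (B : R).
Hypothesis CB : forall q v, `|C q v| <= B * `|q| * `|v|.

Lemma adjCP q v : inner q (adjC C v) = C q v.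
Proof.
move: q; apply: (@xgetPex _ 0 [set p | forall q, inner q p = C q v]).
apply: (@riesz _ _ _ (B * `|v|)) => [k x y|x]; first by rewrite linearP.
by rewrite mulrAC CB.
Qed.

Lemma adjCD v w : adjC C (v + w) = adjC C v + adjC C w.
Proof. by apply: inner_inj => q; rewrite innerDr !adjCP linearD. Qed.

Lemma adjCZ k v : adjC C (k *: v) = k *: adjC C v.
Proof. by apply: inner_inj => q; rewrite innerZr !adjCP dualZ. Qed.

Lemma adjCN v : adjC C (- v) = - adjC C v.
Proof. by rewrite -scaleN1r adjCZ scaleN1r. Qed.

Lemma adjC_norm_le v : `|adjC C v| <= `|B| * `|v|.
Proof.
have [->|T0] := eqVneq (adjC C v) 0; first by rewrite normr0 mulr_ge0.
rewrite -(@ler_pM2r _ `|adjC C v|) ?normr_gt0// -expr2 -inner_norm adjCP.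
apply: (le_trans (ler_norm _)); apply: (le_trans (CB _ _)).
by rewrite mulrAC ler_wpM2r// ler_wpM2r// ler_norm.
Qed.

(* Minimizing [|e - C^* v|^2] over [v], which is coercive because [C^*] is bounded
   below, shows that the range of [C^*] is closed; injectivity of [C] makes it
   dense. *)
Lemma adjC_surjective (m : R) : 0 < m ->
  (forall v, m * `|v| <= `|adjC C v|) ->
  (forall q, (forall v, C q v = 0) -> q = 0) ->
  forall e, exists v, adjC C v = e.
Proof.
move=> m0 low inj e; pose J v := `|e - adjC C v| ^+ 2.
have cT : continuous (adjC C).
  apply: (@bounded_dist_continuous _ _ _ _ `|B|) => x y.
  by rewrite -adjCN -adjCD adjC_norm_le.
have cJ : continuous J.
  move=> v; apply: cvgM; apply: cvg_norm; apply: cvgB; try exact: cT;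
    exact: cvg_cst.
have [|||x y _ _|p _ pmin] := @ex_minimizer _ _ setT J (2 / m ^+ 2) 0 closedT _ cJ.
- by exists 0.
- by rewrite divr_gt0 ?exprn_gt0.
- by move=> x _; rewrite exprn_ge0.
- exists (2^-1 *: x + 2^-1 *: y) => //.
  (* The parallelogram law in the image; the lower bound [m] carries it back to [x - y], whence the
     constant [2 / m ^+ 2]. *)
  have -> : J x + J y - 2 * J (2^-1 *: x + 2^-1 *: y) = `|adjC C (x - y)| ^+ 2 / 2.
    rewrite /J !adjCD !adjCZ adjCN -!inner_norm !innerE.
    by rewrite !(innerC _ e) (innerC (adjC C y) (adjC C x)); field.
  rewrite (_ : _ * (_ / 2) = `|adjC C (x - y)| ^+ 2 / m ^+ 2); last first.
    by field; rewrite gt_eqF.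
  rewrite ler_pdivlMr ?exprn_gt0// -exprMn mulrC.
  by rewrite ler_sqr ?nnegrE ?mulr_ge0 ?(ltW m0).
have pe h : inner (e - adjC C p) (adjC C h) <= 0.
  suff : 2 * inner (e - adjC C p) (adjC C h) <= 0 by lra.
  apply: (@le0_of_small_mul _ _ (`|adjC C h| ^+ 2)) => t t0 _.
  have := pmin (p + t *: h) I.
  rewrite /J adjCD adjCZ opprD addrA [leRHS]normB_sqr innerZr normrZ exprMn.
  by rewrite (gtr0_norm t0) => H; rewrite -(@ler_pM2l _ t)//; lra.
(* The residual [e - adjC C p] is orthogonal to the range of [adjC C], hence annihilated by [C]. *)
exists p; apply/esym/eqP; rewrite -subr_eq0; apply/eqP/inj => v.
rewrite -adjCP; apply/eqP; rewrite eq_le pe.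
by have := pe (- v); rewrite adjCN innerNr lerNl oppr0.
Qed.

End Adjoint.

(** * Consequences of the inf-sup condition *)

Section InfSup.
Variables (R : realType) (V1 V2 : hilbertType R) (A : {linear V1 -> dual V2}).
Variables (ma Ma : R).
Hypotheses (hMa : sup_sup A = Ma%:E) (hma : inf_sup A = ma%:E) (ma0 : 0 < ma)
  (injA : forall v1, (forall v2, A v1 v2 = 0) -> v1 = 0).

Let norm_normalize (W : hilbertType R) (w : W) : w != 0 -> `| `|w|^-1 *: w| = 1.
Proof. by move=> w0; rewrite normrZ normfV normr_id mulVf// normr_eq0. Qed.

Let AN v1 v2 : A (- v1) v2 = - A v1 v2.
Proof. by rewrite linearN. Qed.

Let AZ k v1 v2 : A (k *: v1) v2 = k * A v1 v2.
Proof. by rewrite linearZ. Qed.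

(** Over a trivial [V1] the supremum would be that of the empty set, which is not finite. The unit
    vector later shows that [MI] is nonnegative. *)
Lemma sup_sup_unit : exists v1 : V1, `|v1| = 1.
Proof.
apply: contrapT => /forallNP V10; move: hMa; rewrite /sup_sup.
by rewrite (_ : @unit_sphere R V1 = set0) ?image_set0 ?ereal_sup0// -subset0.
Qed.

Lemma sup_sup_le v1 v2 : A v1 v2 <= Ma * `|v1| * `|v2|.
Proof.
have [->|v10] := eqVneq v1 0; first by rewrite linear0 normr0 mulr0 mul0r.
have [->|v20] := eqVneq v2 0; first by rewrite linear0 normr0 mulr0.
have n1 : 0 < `|v1| by rewrite normr_gt0.
have n2 : 0 < `|v2| by rewrite normr_gt0.
have : ((A (`|v1|^-1 *: v1) (`|v2|^-1 *: v2))%:E <= Ma%:E)%E.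
  rewrite -hMa; apply: le_trans (ereal_sup_ubound _); last first.
    by exists (`|v1|^-1 *: v1) => //; exact: norm_normalize.
  apply: ereal_sup_ubound.
  by exists (`|v2|^-1 *: v2) => //; exact: norm_normalize.
rewrite lee_fin AZ dualZ => /(ler_wpM2r (ltW (mulr_gt0 n1 n2))).
rewrite [leRHS]mulrA; apply: le_trans.
by rewrite le_eqVlt; apply/orP; left; apply/eqP; field; rewrite !gt_eqF.
Qed.

Lemma sup_sup_norm_le v1 v2 : `|A v1 v2| <= Ma * `|v1| * `|v2|.
Proof.
rewrite ler_norml sup_sup_le andbT lerNl -AN.
by rewrite (le_trans (sup_sup_le _ _))// normrN.
Qed.

(** By Cauchy-Schwarz the supremum over unit [v1] is at most the norm of the Riesz representative of
    [a(., v2)]. *)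
Lemma inf_sup_adjC_le v2 : ma * `|v2| <= `|adjC A v2|.
Proof.
have [->|v20] := eqVneq v2 0; first by rewrite normr0 mulr0.
have n2 : 0 < `|v2| by rewrite normr_gt0.
have : (ma%:E <= (`|v2|^-1 * `|adjC A v2|)%:E)%E.
  rewrite -hma; apply: le_trans (ereal_inf_lbound _) _.
    by exists (`|v2|^-1 *: v2) => //; exact: norm_normalize.
  apply: ge_ereal_sup => _ [v1 /= v11 <-]; rewrite lee_fin dualZ.
  rewrite ler_pM2l ?invr_gt0// -(adjCP sup_sup_norm_le).
  by apply: (le_trans (inner_le _ _)); rewrite v11 mul1r.
by rewrite lee_fin mulrC ler_pdivlMr.
Qed.

(** This is the form used for the adjoint error. Testing with the representative of [a(., v2)]
    itself bounds its norm by [N]. *)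
Lemma inf_sup_le (v2 : V2) (N : R) : 0 <= N ->
  (forall v1, `|A v1 v2| <= N * `|v1|) -> ma * `|v2| <= N.
Proof.
move=> N0 hN; apply: (le_trans (inf_sup_adjC_le _)).
have [->|T0] := eqVneq (adjC A v2) 0; first by rewrite normr0.
rewrite -(@ler_pM2r _ `|adjC A v2|) ?normr_gt0// -expr2 -inner_norm.
by rewrite (adjCP sup_sup_norm_le) (le_trans (ler_norm _)).
Qed.

Lemma inf_sup_le_sup_sup : ma <= Ma.
Proof.
(* Over a trivial [V2] the infimum would be infinite. *)
have [v2 v2E] : exists v2 : V2, `|v2| = 1.
  apply: contrapT => /forallNP V20; move: hma; rewrite /inf_sup.
  by rewrite (_ : @unit_sphere R V2 = set0) ?image_set0 ?ereal_inf0// -subset0.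
have n2 : 0 < `|v2| by rewrite v2E.
have low := inf_sup_adjC_le v2.
have T0 : 0 < `|adjC A v2| by apply: lt_le_trans low; rewrite mulr_gt0.
have := sup_sup_le (adjC A v2) v2.
rewrite -(adjCP sup_sup_norm_le) inner_norm mulrAC expr2 ler_pM2r// => up.
by rewrite -(ler_pM2r n2) (le_trans low).
Qed.

(* Surjectivity of [A^*] transfers the inf-sup constant from [V2] to [V1]. *)
Lemma inf_sup_dual_le v1 : ma * `|v1| <= dual_norm (A v1).
Proof.
have [->|v10] := eqVneq v1 0; first by rewrite normr0 mulr0 dual_norm_ge0.
have n1 : 0 < `|v1| by rewrite normr_gt0.
(* With [v1] as representative of [a(., v2)], the square of its norm is [A v1 v2], while
   [ma * |v2| <= |v1|]. *)
have [v2 v2E] := adjC_surjective sup_sup_norm_le ma0 inf_sup_adjC_le injA v1.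
have h := inf_sup_adjC_le v2; rewrite v2E in h.
rewrite -(ler_pM2r n1) -mulrA -expr2 -inner_norm -{2}v2E (adjCP sup_sup_norm_le).
have H := le_trans (ler_norm _) (dual_le (A v1) v2).
apply: (@le_trans _ _ (ma * (dual_norm (A v1) * `|v2|))); first by rewrite ler_pM2l.
by rewrite mulrCA ler_wpM2l// dual_norm_ge0.
Qed.

End InfSup.

(** * The Euclidean norm on pairs of scalars *)

Section Hypot.
Variable R : realType.
Implicit Types a b c d : R.

Definition hypot a b := Num.sqrt (a ^+ 2 + b ^+ 2).

Lemma hypot_ge0 a b : 0 <= hypot a b.
Proof. exact: sqrtr_ge0. Qed.

Lemma sqr_hypot a b : hypot a b ^+ 2 = a ^+ 2 + b ^+ 2.
Proof. by rewrite sqr_sqrtr// addr_ge0 ?sqr_ge0. Qed.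

Lemma hypot_dot_le a b c d : a * c + b * d <= hypot a b * hypot c d.
Proof.
apply: (le_trans (ler_norm _)).
rewrite -ler_sqr ?nnegrE ?mulr_ge0 ?hypot_ge0// exprMn.
rewrite !sqr_hypot real_normK ?num_real//.
by have := sqr_ge0 (a * d - b * c); lra.
Qed.

Lemma hypotD_le a b c d : hypot (a + c) (b + d) <= hypot a b + hypot c d.
Proof.
rewrite -ler_sqr ?nnegrE ?addr_ge0 ?hypot_ge0// [leRHS]sqrrD !sqr_hypot.
by have := hypot_dot_le a b c d; lra.
Qed.

Lemma hypot_le a b c d :
  0 <= a -> 0 <= b -> a <= c -> b <= d -> hypot a b <= hypot c d.
Proof.
move=> a0 b0 ac bd; rewrite ler_sqrt ?addr_ge0 ?sqr_ge0//.
by rewrite lerD// ler_sqr ?nnegrE// (le_trans _ ac, le_trans _ bd).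
Qed.

Lemma hypotZ k a b : 0 <= k -> hypot (k * a) (k * b) = k * hypot a b.
Proof.
move=> k0; rewrite /hypot !exprMn -mulrDr sqrtrM ?sqr_ge0//.
by rewrite sqrtr_sqr ger0_norm.
Qed.

Lemma hypotx0 a : 0 <= a -> hypot a 0 = a.
Proof. by move=> a0; rewrite /hypot expr0n addr0 sqrtr_sqr ger0_norm. Qed.

Lemma le_hypotl a b : a <= hypot a b.
Proof.
apply: (le_trans (ler_norm _)).
by rewrite -sqrtr_sqr ler_sqrt ?addr_ge0 ?sqr_ge0// lerDl sqr_ge0.
Qed.

Lemma le_hypotr a b : b <= hypot a b.
Proof. by rewrite /hypot addrC; exact: le_hypotl. Qed.

Lemma hypot_leD a b : 0 <= a -> 0 <= b -> hypot a b <= a + b.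
Proof.
move=> a0 b0; rewrite -ler_sqr ?nnegrE ?hypot_ge0 ?addr_ge0// sqr_hypot.
by have := mulr_ge0 a0 b0; lra.
Qed.

End Hypot.

(** * Scalar inequalities and the constants *)

Section Scalar.
Variable R : realType.

(** The left side is the factor produced by [error_estimate]. It is absorbed because
    [(1 + 2 * L) / (1 + L)] is at least 1 and [1 + 2 * L] dominates [L]. *)
Lemma kappa_ge (ma M alpha : R) : 0 < ma -> 0 <= M -> 0 < alpha ->
  1 + M * (M / Num.sqrt alpha) / ma <= kappa ma M alpha.
Proof.
move=> ma0 M0 a0; rewrite /kappa /=.
have s0 : 0 < Num.sqrt alpha by rewrite sqrtr_gt0.
set L := M / Num.sqrt alpha.
have L0 : 0 <= L by rewrite divr_ge0// ltW.
have x0 : 0 <= M / ma by rewrite divr_ge0// ltW.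
have -> : M * L / ma = M / ma * L by rewrite mulrAC.
have h1 : 1 <= (1 + 2 * L) / (1 + L) by rewrite ler_pdivlMr; lra.
have h2 : 0 <= M / ma * L by rewrite mulr_ge0.
apply: le_trans (ler_peMl _ h1); lra.
Qed.

Lemma kappa_ge1 (ma M alpha : R) : 0 < ma -> 0 <= M -> 0 < alpha ->
  1 <= kappa ma M alpha.
Proof.
move=> ma0 M0 a0; apply: le_trans (kappa_ge ma0 M0 a0).
by rewrite lerDl divr_ge0 ?(ltW ma0)// mulr_ge0// divr_ge0// sqrtr_ge0.
Qed.

(** If [X > P + r], adding [X * (X - P - r) > 0] and [r * (X - P) >= 0] contradicts the
    hypothesis. *)
Lemma le_of_sqr_le (X P r : R) :
  0 <= P -> 0 <= r -> X ^+ 2 <= P * (r + X) -> X <= P + r.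
Proof.
move=> P0 r0 h; rewrite leNgt; apply/negP => PX.
have h1 : 0 < (X - P - r) * X by rewrite mulr_gt0; lra.
have h2 : 0 <= r * (X - P) by rewrite mulr_ge0//; lra.
by move: h h1 h2; rewrite expr2; lra.
Qed.

(** Since [M * p = L * (s * p)], Minkowski turns the linear bounds into [ma * D <= r + L * d], and
    Cauchy-Schwarz turns the energy bound into [d ^+ 2 <= s * (r * D)]. Eliminating [D] leaves a
    quadratic inequality for [L * d]. *)
Lemma error_estimate (ma M s e y p i r1 r2 : R) :
  0 < ma -> 0 <= M -> 0 < s -> 0 <= e -> 0 <= y ->
  ma * e <= r2 + M * p -> ma * y <= r1 + M / s * i ->
  (s * p) ^+ 2 + i ^+ 2 <= s * (r2 * y + r1 * e) ->
  let L := M / s in let k := 1 + M * L / ma in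
  L * hypot (s * p) i <= k * hypot r2 r1 /\ ma * hypot e y <= 2 * k * hypot r2 r1.
Proof.
move=> ma0 M0 s0 e0 y0 he hy hd L k.
set d := hypot _ i; set D := hypot e y; set r := hypot r2 r1.
have L0 : 0 <= L by rewrite divr_ge0// ltW.
have r0 : 0 <= r by exact: hypot_ge0.
have D0 : 0 <= D by exact: hypot_ge0.
have DL : ma * D <= r + L * d.
  rewrite /d /D -!hypotZ ?(ltW ma0)//.
  rewrite mulrA (_ : L * s = M); last by rewrite /L divfK// gt_eqF.
  apply: le_trans (hypotD_le _ _ _ _).
  by apply: hypot_le => //; rewrite mulr_ge0// ltW.
have dd : d ^+ 2 <= s * (r * D).
  rewrite sqr_hypot (le_trans hd)// ler_pM2l//.
  have -> : D = hypot y e by rewrite /D /hypot addrC.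
  exact: hypot_dot_le.
have P0 : 0 <= M * L / ma * r.
  by rewrite mulr_ge0// divr_ge0 ?(ltW ma0)// mulr_ge0.
have Ld : L * d <= M * L / ma * r + r.
  apply: le_of_sqr_le => //.
  apply: (@le_trans _ _ (M * L / ma * r * (ma * D))); last by rewrite ler_wpM2l.
  rewrite exprMn (_ : M * L / ma * r * (ma * D) = L ^+ 2 * (s * (r * D))).
    by rewrite ler_wpM2l ?exprn_ge0.
  by rewrite /L; field; rewrite !gt_eqF.
rewrite /k; split; lra.
Qed.

Lemma upper_bound_scalar (ma Ma M s e y p i r1 r2 h p' k : R) :
  0 < ma -> ma <= Ma -> 0 <= M -> 0 < s ->
  0 <= e -> 0 <= y -> 0 <= r1 -> 0 <= r2 -> 0 <= h ->
  ma * e <= r2 + M * h + M * p -> ma * y <= r1 + M / s * i ->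
  (s * p) ^+ 2 + i ^+ 2 <= s * ((r2 + M * h) * y + r1 * e) ->
  p' <= p + h -> 1 <= k -> 1 + M * (M / s) / ma <= k ->
  hypot e y + s^-1 * (M / Ma) * hypot (s * p) i + M / Ma * p' <=
  (4 + 5 * Ma) * (k / ma) * (hypot r2 r1 + M / Ma * h).
Proof.
move=> ma0 maMa M0 s0 e0 y0 r10 r20 h0 he hy hd hp k1 hk.
have Ma0 : 0 < Ma by exact: lt_le_trans maMa.
have [hLd hD] := error_estimate ma0 M0 s0 e0 y0 he hy hd.
set d := hypot _ i in hLd *; set D := hypot e y in hD *.
set rr := hypot (r2 + _) r1 in hLd hD.
set Rs := hypot r2 r1 + M / Ma * h.
have MMa : 0 <= M / Ma by rewrite divr_ge0// ltW.
have hR : M / Ma * h <= Rs by rewrite lerDr hypot_ge0.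
have Rs0 : 0 <= Rs by rewrite addr_ge0 ?hypot_ge0// mulr_ge0.
have rr0 : 0 <= rr by exact: hypot_ge0.
(* The perturbation [M * h] is [Ma] times a part of [Rs], which costs the factor [1 + Ma]. *)
have hrr : rr <= (1 + Ma) * Rs.
  have : rr <= hypot r2 r1 + M * h.
    rewrite -[in leRHS](hypotx0 (mulr_ge0 M0 h0)) /rr -[r1 in leLHS]addr0.
    exact: hypotD_le.
  have -> : M * h = Ma * (M / Ma * h) by field; rewrite gt_eqF.
  have : hypot r2 r1 <= Rs by rewrite lerDl mulr_ge0.
  have : Ma * (M / Ma * h) <= Ma * Rs by rewrite ler_pM2l.
  by lra.
have krr : k * rr <= k * ((1 + Ma) * Rs) by rewrite ler_wpM2l//; lra.
have Ldk : M / s * d <= k * ((1 + Ma) * Rs).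
  apply: (le_trans hLd); apply: le_trans krr; exact: ler_wpM2r.
have Dk : ma * D <= 2 * (k * ((1 + Ma) * Rs)).
  apply: (le_trans hD); rewrite -mulrA ler_pM2l//; apply: le_trans krr.
  exact: ler_wpM2r.
have psd : M / Ma * p <= M / s * d / Ma.
  have -> : M / Ma * p = M / s * (s * p) / Ma by field; rewrite !gt_eqF.
  rewrite ler_pM2r ?invr_gt0// ler_wpM2l ?le_hypotl//.
  by rewrite divr_ge0// ltW.
have hp' : M / Ma * p' <= M / Ma * p + M / Ma * h.
  by rewrite -mulrDr ler_wpM2l.
have -> : s^-1 * (M / Ma) * d = M / s * d / Ma by field; rewrite !gt_eqF.
have LdMa : M / s * d / Ma <= k * ((1 + Ma) * Rs) / ma.
  apply: (@le_trans _ _ (k * ((1 + Ma) * Rs) / Ma)).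
    by rewrite ler_pM2r ?invr_gt0.
  rewrite ler_wpM2l ?lef_pV2 ?posrE// !mulr_ge0//; lra.
have DD : D <= 2 * (k * ((1 + Ma) * Rs) / ma).
  by rewrite mulrA ler_pdivlMr// mulrC.
have Rk : Rs <= k * (Ma * Rs) / ma.
  rewrite ler_pdivlMr// mulrA [leRHS]mulrC ler_wpM2l// -[ma]mul1r.
  by apply: ler_pM => //; lra.
(* Of the four multiples of [1 + Ma], two pay for [D], one for the [d] term and one for [p]; the
   additional [Ma] pays for [h]. *)
have -> : (4 + 5 * Ma) * (k / ma) * Rs
  = 4 * (k * ((1 + Ma) * Rs) / ma) + k * (Ma * Rs) / ma.
  by field; rewrite gt_eqF.
lra.
Qed.

(** In the factor [2 * Ma + 1], the multiple [2 * Ma] of the error covers [r1 + r2], and one more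
    copy covers [M / Ma * h]. *)
Lemma lower_bound_scalar (Ma M s e y p i r1 r2 h p' : R) :
  0 < Ma -> 0 <= M -> 0 < s -> 0 <= r1 -> 0 <= r2 -> 0 <= p' ->
  r2 <= Ma * e + M * p' -> r1 <= Ma * y + M / s * i -> h <= p + p' ->
  (2 * Ma + 1)^-1 * (hypot r2 r1 + M / Ma * h) <=
  hypot e y + s^-1 * (M / Ma) * hypot (s * p) i + M / Ma * p'.
Proof.
move=> Ma0 M0 s0 r10 r20 p'0 h2 h1 hh.
set D := hypot e y; set d := hypot _ i.
have MMa : 0 <= M / Ma by rewrite divr_ge0// ltW.
have Ms : 0 <= M / s by rewrite divr_ge0// ltW.
rewrite ler_pdivrMl; last by lra.
have eD : Ma * e <= Ma * D by rewrite ler_pM2l// le_hypotl.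
have yD : Ma * y <= Ma * D by rewrite ler_pM2l// le_hypotr.
have id : M / s * i <= M / s * d by rewrite ler_wpM2l// le_hypotr.
have D0 : 0 <= D by exact: hypot_ge0.
have d0 : 0 <= d by exact: hypot_ge0.
have Md : 0 <= M / s * d by rewrite mulr_ge0.
have Mp : 0 <= M * p' by rewrite mulr_ge0.
have hr := hypot_leD r20 r10.
have pd : M / Ma * p <= s^-1 * (M / Ma) * d.
  have -> : M / Ma * p = s^-1 * (M / Ma) * (s * p) by field; rewrite !gt_eqF.
  by rewrite ler_wpM2l ?le_hypotl// mulr_ge0// invr_ge0 ltW.
have hM : M / Ma * h <= M / Ma * p + M / Ma * p' by rewrite -mulrDr ler_wpM2l.
rewrite mulrDl mul1r.
have -> : 2 * Ma * (D + s^-1 * (M / Ma) * d + M / Ma * p')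
  = 2 * (Ma * D) + 2 * (M / s * d) + 2 * (M * p') by field; rewrite !gt_eqF.
lra.
Qed.

End Scalar.

(** * Residuals and errors of the optimality system *)

Section ResidualEstimate.
Variables (R : realType) (V1 V2 Q W : hilbertType R).
Variables (A : {linear V1 -> dual V2}) (C : {linear Q -> dual V2})
  (I : {linear V1 -> W}) (K : set Q) (f : dual V2) (ud : W)
  (ma Ma M alpha : R).
Hypotheses (hMa : sup_sup A = Ma%:E) (hma : inf_sup A = ma%:E) (ma0 : 0 < ma)
  (injA : forall v1, (forall v2, A v1 v2 = 0) -> v1 = 0)
  (M0 : 0 <= M)
  (CM : forall q v, `|C q v| <= M * `|q| * `|v|)
  (IM : forall v, `|I v| <= M * `|v|)
  (K0 : K !=set0) (clK : closed K)
  (cvK : convex_set (K : set (convex_lmodType Q)))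
  (alpha0 : 0 < alpha).
Variables (x : V1 * V2) (ut : V1) (zt : V2) (qt : Q).
Hypotheses (hx : solves A C I K alpha f ud x).

Let s := Num.sqrt alpha.
Let q := control C K alpha x.2.
Let qb := control C K alpha zt.
Let e := x.1 - ut.
Let y := x.2 - zt.
Let r2 : dual V2 := f - A ut + C qt.
Let r1 : V1 -> R^o := adjA A zt - s^-1 *: adjI I (I ut - ud).

Let s0 : 0 < s. Proof. by rewrite sqrtr_gt0. Qed.

Let adjC0 : adjC C 0 = 0.
Proof. by rewrite -(scale0r 0) (adjCZ CM) scale0r. Qed.

(** Test pairs [(0, w)] isolate the state equation; pairs [(v, 0)] isolate the adjoint equation
    below. *)
Let state_eq w : A x.1 w - C q w = f w.
Proof.
have A0 : A 0 x.2 = 0 by rewrite linear0.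
have := hx (0, w); rewrite /b_form /= (adjCP CM) -/q A0 linear0.
by rewrite !inner0r !mulr0 !subr0 addr0.
Qed.

Let adjoint_eq v : A v x.2 = s^-1 * inner (I x.1 - ud) (I v).
Proof.
have := hx (v, 0); rewrite /b_form /= adjC0 !linear0 -/s.
rewrite inner0r !innerE => h.
by rewrite mulrDr mulrN; move: h; lra.
Qed.

(** Subtracting the exact equations eliminates [f] here and [ud] in [r1E], so both residuals depend
    on the errors alone. *)
Let r2E w : r2 w = A e w - C (q - qt) w.
Proof.
by rewrite /r2 /e !lin_dualB dualDE dualDE dualNE -(state_eq w); lra.
Qed.

Let r1E v : r1 v = - A v y + s^-1 * inner (I v) (I e).
Proof.
have -> : I e = I x.1 - I ut by rewrite linearB.
rewrite /r1 /y /adjA /adjI !fctE linearB /= adjoint_eq /GRing.scale /=.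
by rewrite !innerE !(innerC _ (I v)); lra.
Qed.

Let r1Z k v : r1 (k *: v) = k * r1 v.
Proof. by rewrite !r1E lin_dualZ [I (k *: v)]linearZ innerZl; ring. Qed.

Let r1_norm_le v : `|r1 v| <= (Ma * `|y| + M / s * `|I e|) * `|v|.
Proof.
rewrite r1E (le_trans (ler_normD _ _))// normrN mulrDl lerD//.
  by rewrite mulrAC (sup_sup_norm_le hMa).
rewrite normrM ger0_norm ?invr_ge0 ?(ltW s0)//.
rewrite (_ : M / s * _ * _ = s^-1 * (M * `|v| * `|I e|)); last by ring.
rewrite ler_pM2l ?invr_gt0// (le_trans (norm_inner_le _ _))//.
by rewrite ler_wpM2r.
Qed.

Let N1 := dual_norm r1.
Let N2 := dual_norm r2.

Let r1_le v : `|r1 v| <= N1 * `|v|.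
Proof. exact: dual_norm_bound r1Z r1_norm_le v. Qed.

(** Monotonicity compares two projected controls, so [qt] has to be replaced by [qb]; this costs
    [M * |qt - qb|]. *)
Let perturbed_r2_le w :
  `|A e w - C (q - qb) w| <= (N2 + M * `|qt - qb|) * `|w|.
Proof.
have -> : A e w - C (q - qb) w = r2 w - C (qt - qb) w.
  by rewrite r2E !lin_dualB; lra.
by rewrite (le_trans (ler_normB _ _))// mulrDl lerD ?dual_le// CM.
Qed.

Let state_error_le : ma * `|e| <= N2 + M * `|qt - qb| + M * `|q - qb|.
Proof.
apply: le_trans (inf_sup_dual_le hMa hma ma0 injA e) _.
apply: dual_norm_le => [|w].
  by rewrite !addr_ge0 ?dual_norm_ge0 ?mulr_ge0.
rewrite -[A e w](subrK (C (q - qb) w)) (le_trans (ler_normD _ _))//.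
by rewrite [leRHS]mulrDl lerD ?perturbed_r2_le.
Qed.

Let adjoint_error_le : ma * `|y| <= N1 + M / s * `|I e|.
Proof.
have Ms : 0 <= M / s by rewrite divr_ge0// ltW.
apply: (inf_sup_le hMa hma) => [|v].
  by apply: addr_ge0; [exact: dual_norm_ge0|exact: mulr_ge0].
have -> : A v y = s^-1 * inner (I v) (I e) - r1 v by rewrite r1E; lra.
rewrite (le_trans (ler_normB _ _))// mulrDl addrC lerD// normrM.
rewrite ger0_norm ?invr_ge0 ?(ltW s0)//.
rewrite (_ : M / s * _ * _ = s^-1 * (M * `|v| * `|I e|)); last by ring.
rewrite ler_pM2l ?invr_gt0// (le_trans (norm_inner_le _ _))//.
by rewrite ler_wpM2r.
Qed.

(* Testing the perturbed residuals with [y] and [e] cancels [a(e, y)]; the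
   monotonicity of the projection makes what remains coercive. *)
Let energy_le : (s * `|q - qb|) ^+ 2 + `|I e| ^+ 2
  <= s * ((N2 + M * `|qt - qb|) * `|y| + N1 * `|e|).
Proof.
have mono : s * `|q - qb| ^+ 2 <= - C (q - qb) y.
  have := proj_monotone K0 clK cvK (- s^-1 *: adjC C x.2) (- s^-1 *: adjC C zt).
  rewrite -/(control C K alpha x.2) -/(control C K alpha zt) -/q -/qb.
  rewrite -scalerBr -(adjCN CM) -(adjCD CM) -/y innerZl innerC (adjCP CM).
  move=> /(ler_wpM2l (ltW s0)).
  by rewrite mulNr mulrN [s * (s^-1 * _)]mulrA divff ?gt_eqF// mul1r.
have h2 := le_trans (ler_norm _) (perturbed_r2_le y).
have := le_trans (ler_norm _) (r1_le e).
rewrite r1E inner_norm => h1.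
rewrite exprMn expr2 -mulrA.
rewrite (_ : `|I e| ^+ 2 = s * (s^-1 * `|I e| ^+ 2)); last first.
  by rewrite mulrA divff ?gt_eqF// mul1r.
by rewrite -mulrDr ler_pM2l//; lra.
Qed.

Let r2_norm_le : N2 <= Ma * `|e| + M * `|q - qt|.
Proof.
have Ma0 : 0 <= Ma.
  by rewrite (le_trans (ltW ma0))// (inf_sup_le_sup_sup hMa hma ma0).
apply: dual_norm_le => [|w]; first by rewrite addr_ge0// mulr_ge0.
rewrite r2E (le_trans (ler_normB _ _))// mulrDl lerD//.
exact: (sup_sup_norm_le hMa).
Qed.

Let r1_dual_norm_le : N1 <= Ma * `|y| + M / s * `|I e|.
Proof.
have Ma0 : 0 <= Ma.
  by rewrite (le_trans (ltW ma0))// (inf_sup_le_sup_sup hMa hma ma0).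
apply: dual_norm_le r1_norm_le.
by rewrite addr_ge0// mulr_ge0// divr_ge0// ltW.
Qed.

Let errorE : d_alpha C I K Ma M alpha x (ut, zt) + M / Ma * `|q - qt|
  = hypot `|e| `|y| + s^-1 * (M / Ma) * hypot (s * `|q - qb|) `|I e|
    + M / Ma * `|q - qt|.
Proof.
by rewrite /d_alpha /delta_alpha /hypot exprMn sqr_sqrtr ?(ltW alpha0).
Qed.

Lemma residual_estimate :
  let E := d_alpha C I K Ma M alpha x (ut, zt) + M / Ma * `|q - qt| in
  let Res := hypot N2 N1 + M / Ma * `|qt - qb| in
  (2 * Ma + 1)^-1 * Res <= E <= (4 + 5 * Ma) * (kappa ma M alpha / ma) * Res.
Proof.
have maMa := inf_sup_le_sup_sup hMa hma ma0.
have := (state_error_le, adjoint_error_le, energy_le).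
have := (r2_norm_le, r1_dual_norm_le).
rewrite /= errorE => -[? ?] [[? ?] ?]; apply/andP; split.
  apply: (@lower_bound_scalar _ _ _ _ _ _ _ _ N1 N2) => //; rewrite ?dual_norm_ge0//.
    exact: lt_le_trans maMa.
  by rewrite [leRHS]addrC (distrC q qt) ler_distD.
apply: upper_bound_scalar => //; rewrite ?dual_norm_ge0//.
- by rewrite (distrC qt) ler_distD.
- exact: kappa_ge1.
- exact: kappa_ge.
Qed.

End ResidualEstimate.

(** * Behaviour of the constants as [alpha -> 0] *)

Section Asymptotics.
Variable R : realType.

Lemma scale_eqTheta (F : filter_on R) (g : R -> R) (k : R) :
  0 < k -> (fun x => k * g x) =Theta_F g.
Proof.
move=> k0; rewrite eqThetaE qualifE; apply/asboolP; exists (k, k) => /=.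
  by rewrite k0.
by apply: nearW => x; rewrite normrM gtr0_norm.
Qed.

Lemma kappa_eqO (ma M : R) : 0 < ma -> 0 <= M ->
  (fun alpha => kappa ma M alpha) =O_ (0^'+) (fun alpha => 1 / Num.sqrt alpha).
Proof.
move=> ma0 M0; have x0 : 0 <= M / ma by rewrite divr_ge0// ltW.
(* The quotient in [kappa] is at most 2; for [alpha <= 1] each constant 1 in the other factor is at
   most [1 / Num.sqrt alpha]. *)
apply/eqO_exP; exists (2 * (1 + M / ma * (1 + 2 * M))).
  by rewrite mulr_gt0// ltr_wpDr// mulr_ge0//; lra.
near=> alpha.
have a0 : 0 < alpha by near: alpha; exact: nbhs_right_gt.
have a1 : alpha <= 1 by near: alpha; exact: nbhs_right_le.
have s0 : 0 < Num.sqrt alpha by rewrite sqrtr_gt0.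
have s1 : Num.sqrt alpha <= 1 by rewrite -sqrtr1 ler_sqrt.
rewrite (gtr0_norm (lt_le_trans ltr01 (kappa_ge1 ma0 M0 a0))) div1r.
rewrite gtr0_norm ?invr_gt0// /kappa /=.
set s := Num.sqrt alpha in s0 s1 *.
have L0 : 0 <= M / s by rewrite divr_ge0// ltW.
have is1 : 1 <= s^-1 by rewrite invf_ge1.
rewrite -[leRHS]mulrA; apply: ler_pM.
- by rewrite divr_ge0//; lra.
- by rewrite addr_ge0// mulr_ge0//; lra.
- by rewrite ler_pdivrMr; lra.
rewrite [leRHS]mulrDl mul1r lerD// -[leRHS]mulrA ler_wpM2l//.
by rewrite [leRHS]mulrDl mul1r -mulrA lerD2r.
Unshelve. all: by end_near. Qed.

End Asymptotics.

(** * Choice of the constants and assembly of the estimates *)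

Theorem corollary3p3 (R : realType) :
  exists c Cbar : R -> R -> R -> R -> R,
    [/\ forall ma Ma M alpha : R,
          0 < ma -> 0 < Ma -> 0 <= M -> 0 < alpha ->
          0 < c ma Ma M alpha /\ 0 < Cbar ma Ma M alpha,

        forall (V1 V2 Q W : hilbertType R)
          (A : {linear V1 -> dual V2}) (C : {linear Q -> dual V2})
          (I : {linear V1 -> W}) (K : set Q) (f : dual V2) (ud : W)
          (ma Ma MC MI alpha : R),
          sup_sup A = Ma%:E ->
          (forall v1 : V1, (forall v2 : V2, A v1 v2 = 0) -> v1 = 0) ->
          inf_sup A = ma%:E -> 0 < ma ->
          (forall q : Q, dual_norm (C q) <= MC * `|q|) ->
          (forall v1 : V1, `|I v1| <= MI * `|v1|) ->
          K !=set0 -> closed K -> convex_set (K : set (convex_lmodType Q)) ->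
          0 < alpha ->
          let M := Num.max MI MC in
          forall x : V1 * V2, solves A C I K alpha f ud x ->
          let q := control C K alpha x.2 in
          forall (ut : V1) (zt : V2) (qt : Q), K qt ->
          let E := d_alpha C I K Ma M alpha x (ut, zt) + M / Ma * `|q - qt| in
          let Res :=
            Num.sqrt
              (dual_norm (f - A ut + C qt) ^+ 2
               + dual_norm (adjA A zt
                            - (Num.sqrt alpha)^-1 *: adjI I (I ut - ud)) ^+ 2)
            + M / Ma * `|qt - control C K alpha zt| in
          c ma Ma M alpha * Res <= E <= Cbar ma Ma M alpha * Res
      & forall ma Ma M : R, 0 < ma -> 0 < Ma -> 0 <= M ->
          [/\ c ma Ma M =Theta_ (0^'+) (fun=> 1 / Ma : R),
              Cbar ma Ma M =Theta_ (0^'+) (fun alpha => kappa ma M alpha / ma),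
              exists2 c0 : R, 0 < c0 &
                \forall alpha \near 0^'+, c0 <= c ma Ma M alpha,
              Cbar ma Ma M =O_ (0^'+) (fun alpha => kappa ma M alpha)
            & (fun alpha => kappa ma M alpha)
                =O_ (0^'+) (fun alpha => 1 / Num.sqrt alpha)] ].
Proof.
exists (fun ma Ma M alpha => (2 * Ma + 1)^-1),
  (fun ma Ma M alpha => (4 + 5 * Ma) * (kappa ma M alpha / ma)); split.
- move=> ma Ma M alpha ma0 Ma0 M0 alpha0; split; first by rewrite invr_gt0; lra.
  by rewrite mulr_gt0 ?divr_gt0 ?(lt_le_trans _ (kappa_ge1 _ _ _))//; lra.
- move=> V1 V2 Q W A C I K f ud ma Ma MC MI alpha hMa injA hma ma0 CM IM K0 clK cvK.
  move=> alpha0 M x hx q ut zt qt _.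
  apply: residual_estimate => //.
  (* A nonzero vector of [V1] forces [MI], and with it [M], to be nonnegative. *)
  + have [v1 v10] : exists v1 : V1, v1 != 0.
      have [v1 v1E] := sup_sup_unit hMa.
      by exists v1; rewrite -normr_gt0 v1E.
    rewrite le_max; apply/orP; left.
    rewrite -(@pmulr_lge0 _ `|v1|) ?normr_gt0//; exact: le_trans (IM v1).
  + move=> p v; apply: (le_trans (dual_le _ _)); rewrite ler_wpM2r//.
    by apply: (le_trans (CM _)); rewrite ler_wpM2r// le_max lexx orbT.
  + by move=> v; apply: (le_trans (IM _)); rewrite ler_wpM2r// le_max lexx.
move=> ma Ma M ma0 Ma0 M0; split.
- have -> : (fun _ : R => (2 * Ma + 1)^-1) = (fun _ => Ma / (2 * Ma + 1) * (1 / Ma)).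
    by apply/funext => _; field; rewrite gt_eqF//=; lra.
  by apply: scale_eqTheta; rewrite divr_gt0//; lra.
- by apply: scale_eqTheta; lra.
- by exists (2 * Ma + 1)^-1; [rewrite invr_gt0; lra|exact: nearW].
- apply/eqO_exP; exists ((4 + 5 * Ma) / ma); first by rewrite divr_gt0//; lra.
  apply: nearW => alpha; rewrite 2!normrM normfV (gtr0_norm ma0) gtr0_norm; last lra.
  by rewrite le_eqVlt; apply/orP; left; apply/eqP; ring.
- exact: kappa_eqO.
Qed.
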